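(* The faces of the common self-polar tetrahedron $\mathcal{P}$ of the inscribed quadrics $\mathcal{Q}_\lambda$ of the extended oloid are formed by the planes $$\mathcal{X}_1=\{[x_0,x_1,x_2,x_3]\in\mathbb{P}_3(\mathbb{C}): x_1=0\},\qquad \mathcal{X}_3=\{[x_0,x_1,x_2,x_3]\in\mathbb{P}_3(\mathbb{C}): x_3=0\},$$ $$\mathcal{I}_1=\left\{[x_0,x_1,x_2,x_3]\in\mathbb{P}_3(\mathbb{C}): x_2=\tfrac{\sqrt3}2\,\mathrm{i}\,x_0\right\},\qquad \mathcal{I}_2=\left\{[x_0,x_1,x_2,x_3]\in\mathbb{P}_3(\mathbb{C}): x_2=-\tfrac{\sqrt3}2\,\mathrm{i}\,x_0\right\}.$$ The vertices of $\mathcal{P}$ are the ideal points $X_\infty=[0,1,0,0]$ and $Z_\infty=[0,0,0,1]$ of the $x$-axis and the $z$-axis, respectively, and the points $$P=\left[1,0,\tfrac{\sqrt3}2\,\mathrm{i},0\right],\qquad Q=\left[1,0,-\tfrac{\sqrt3}2\,\mathrm{i},0\right].$$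
   Context: Homogeneous coordinates are $x=x_1/x_0$, $y=x_2/x_0$, $z=x_3/x_0$; $\mathbb{P}_3(\mathbb{C})$ is complex projective 3-space. The inscribed quadrics $\mathcal{Q}_\lambda$ of the extended oloid (the developable surface through the circles $x^2+(y+\frac12)^2=1,z=0$ and $(y-\frac12)^2+z^2=1,x=0$ whose tangent planes are tangent to both circles) form a tangential system with system parameter $\lambda$ and are given in homogeneous coordinates by $$\tilde f_\lambda(x_0,x_1,x_2,x_3)=\frac{x_1^2}{1-\lambda}+\frac{\left(x_2+(\frac12-\lambda)x_0\right)^2}{1-\lambda+\lambda^2}+\frac{x_3^2}{\lambda}-x_0^2=0;$$ in plane coordinates $[u_0,u_1,u_2,u_3]$ the system is $$(1-\lambda)(4u_0^2-4u_0u_2-4u_1^2-3u_2^2)+\lambda(4u_0^2+4u_0u_2-3u_2^2-4u_3^2)=0.$$ A tetrahedron is self-polar with respect to a (non-degenerate) quadric if each of its faces is the polar plane of the opposite vertex; the common self-polar tetrahedron of the system is the tetrahedron that is self-polar with respect to all quadrics of the system. *)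

(* Defs.v *)
From HB Require Import structures.
From mathcomp Require Import all_boot all_order all_algebra.
From mathcomp Require Import complex ring.
From mathcomp Require Import classical_sets reals.

Set Implicit Arguments.
Unset Strict Implicit.
Unset Printing Implicit Defensive.

Import Order.TTheory GRing.Theory Num.Theory.
Local Open Scope classical_set_scope.
Local Open Scope ring_scope.
Local Open Scope complex_scope.

(* The complex numbers are R[i] with R : realType. *)

Section ProjectiveSpace.
Variable R : realType.
Local Notation C := R[i].

(* A point of P_3(C) is a one-dimensional subspace of C^4; the nonzero vectors
   of this subspace are the homogeneous coordinate vectors of the point. *)
Record ppoint := PPoint {
  line :> {vspace 'rV[C]_4};
  dim_line : \dim line = 1%N }.

Lemma dim_vline_neq0 (x : 'rV[C]_4) : x != 0 -> \dim <[x]>%VS = 1%N.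
Proof. by move=> x0; rewrite dim_vline x0. Qed.

Definition point_of (x : 'rV[C]_4) (x0 : x != 0) : ppoint :=
  PPoint (dim_vline_neq0 x0).

Definition hvec (x0 x1 x2 x3 : C) : 'rV[C]_4 :=
  \row_(i < 4) [:: x0; x1; x2; x3]`_i.

Lemma hvec_neq0 (x0 x1 x2 x3 : C) :
  [|| x0 != 0, x1 != 0, x2 != 0 | x3 != 0] -> hvec x0 x1 x2 x3 != 0.
Proof.
apply: contraTneq => /rowP x_eq0.
have := x_eq0 0; rewrite !mxE /= => ->.
have := x_eq0 1; rewrite !mxE /= => ->.
have := x_eq0 2; rewrite !mxE /= => ->.
have := x_eq0 3; rewrite !mxE /= => ->.
by rewrite eqxx.
Qed.

Definition polar_form (f : 'rV[C]_4 -> C) (x y : 'rV[C]_4) : C :=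
  (f (x + y) - f x - f y) / 2.

(* The polar plane of p with respect to the quadric f = 0, where f is a
   quadratic form. *)
Definition polar_plane (f : 'rV[C]_4 -> C) (p : ppoint) : set ppoint :=
  [set q : ppoint | forall x y : 'rV[C]_4,
    x \in line p -> y \in line q -> polar_form f x y = 0].

(* The condition on the vertices says that they are not coplanar. *)
Record tetrahedron := Tetrahedron {
  vertex : 'I_4 -> ppoint;
  vertex_span : (\sum_(i < 4) line (vertex i))%VS = fullv }.

Definition face (T : tetrahedron) (i : 'I_4) : set ppoint :=
  [set q : ppoint | (line q <= \sum_(j < 4 | j != i) line (vertex T j))%VS].

Definition vertices (T : tetrahedron) : set ppoint := range (vertex T).
Definition faces (T : tetrahedron) : set (set ppoint) := range (face T).

Definition self_polar (f : 'rV[C]_4 -> C) (T : tetrahedron) : Prop :=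
  forall i : 'I_4, face T i = polar_plane f (vertex T i).

Definition ftilde (l : C) (x : 'rV[C]_4) : C :=
  x 0 1 ^+ 2 / (1 - l)
  + (x 0 2 + (1 / 2 - l) * x 0 0) ^+ 2 / (1 - l + l ^+ 2)
  + x 0 3 ^+ 2 / l
  - x 0 0 ^+ 2.

(* The parameters for which the equation of the quadric makes sense; the
   quadric is then non-degenerate (lemma ftilde_nondegenerate). *)
Definition admissible : set C :=
  [set l : C | [/\ 1 - l != 0, 1 - l + l ^+ 2 != 0 & l != 0]].

Lemma polar_form_ftilde (l : C) (x y : 'rV[C]_4) :
  polar_form (ftilde l) x y
  = x 0 1 * y 0 1 / (1 - l)
    + (x 0 2 + (1 / 2 - l) * x 0 0) * (y 0 2 + (1 / 2 - l) * y 0 0)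
      / (1 - l + l ^+ 2)
    + x 0 3 * y 0 3 / l
    - x 0 0 * y 0 0.
Proof.
rewrite /polar_form /ftilde !mxE.
have two0 : (2 : C) != 0 by rewrite pnatr_eq0.
apply: (mulIf two0); rewrite divfK //; ring.
Qed.

Lemma ftilde_nondegenerate (l : C) (x : 'rV[C]_4) : admissible l ->
  (forall y : 'rV[C]_4, polar_form (ftilde l) x y = 0) -> x = 0.
Proof.
move=> [h1 h2 h3] hx.
have x1 : x 0 1 = 0.
  have := hx (hvec 0 1 0 0); rewrite polar_form_ftilde !mxE /=.
  rewrite !(mulr0, mulr1, mul0r, addr0, subr0) => /eqP.
  by rewrite mulf_eq0 invr_eq0 (negPf h1) orbF => /eqP.
have x3 : x 0 3 = 0.
  have := hx (hvec 0 0 0 1); rewrite polar_form_ftilde !mxE /=.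
  rewrite !(mulr0, mulr1, mul0r, addr0, add0r, subr0) => /eqP.
  by rewrite mulf_eq0 invr_eq0 (negPf h3) orbF => /eqP.
have x2 : x 0 2 + (1 / 2 - l) * x 0 0 = 0.
  have := hx (hvec 0 0 1 0); rewrite polar_form_ftilde !mxE /=.
  rewrite !(mulr0, mulr1, mul0r, addr0, add0r, subr0) => /eqP.
  by rewrite mulf_eq0 invr_eq0 (negPf h2) orbF => /eqP.
have x0 : x 0 0 = 0.
  have := hx (hvec 1 0 0 0); rewrite polar_form_ftilde !mxE /= x2.
  rewrite !(mulr0, mulr1, mul0r, addr0, add0r) => /eqP.
  by rewrite oppr_eq0 => /eqP.
move: x2; rewrite x0 mulr0 addr0 => x2.
apply/rowP=> i; rewrite mxE.
case: i => [[|[|[|[|//]]]] hi].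
- by rewrite -[RHS]x0; congr (x 0 _); apply: val_inj.
- by rewrite -[RHS]x1; congr (x 0 _); apply: val_inj.
- by rewrite -[RHS]x2; congr (x 0 _); apply: val_inj.
- by rewrite -[RHS]x3; congr (x 0 _); apply: val_inj.
Qed.

Definition common_self_polar (L : set C) (T : tetrahedron) : Prop :=
  forall l : C, L l -> self_polar (ftilde l) T.

Definition halfsqrt3i : C := (Num.sqrt 3 / 2)%:C * 'i.

Definition plane_X1 : set ppoint :=
  [set p : ppoint | forall x : 'rV[C]_4, x \in line p -> x 0 1 = 0].
Definition plane_X3 : set ppoint :=
  [set p : ppoint | forall x : 'rV[C]_4, x \in line p -> x 0 3 = 0].
Definition plane_I1 : set ppoint :=
  [set p : ppoint | forall x : 'rV[C]_4,
    x \in line p -> x 0 2 = halfsqrt3i * x 0 0].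
Definition plane_I2 : set ppoint :=
  [set p : ppoint | forall x : 'rV[C]_4,
    x \in line p -> x 0 2 = - halfsqrt3i * x 0 0].

Fact Xinf_neq0 : hvec 0 1 0 0 != 0.
Proof. by apply: hvec_neq0; rewrite oner_eq0 !orbT. Qed.
Fact Zinf_neq0 : hvec 0 0 0 1 != 0.
Proof. by apply: hvec_neq0; rewrite oner_eq0 !orbT. Qed.
Fact P_neq0 : hvec 1 0 halfsqrt3i 0 != 0.
Proof. by apply: hvec_neq0; rewrite oner_eq0. Qed.
Fact Q_neq0 : hvec 1 0 (- halfsqrt3i) 0 != 0.
Proof. by apply: hvec_neq0; rewrite oner_eq0. Qed.

Definition point_Xinf : ppoint := point_of Xinf_neq0.
Definition point_Zinf : ppoint := point_of Zinf_neq0.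
Definition point_P : ppoint := point_of P_neq0.
Definition point_Q : ppoint := point_of Q_neq0.

End ProjectiveSpace.

Arguments plane_X1 : clear implicits.
Arguments plane_X3 : clear implicits.
Arguments plane_I1 : clear implicits.
Arguments plane_I2 : clear implicits.
Arguments point_Xinf : clear implicits.
Arguments point_Zinf : clear implicits.
Arguments point_P : clear implicits.
Arguments point_Q : clear implicits.

(* Main.v *)
Require Import Defs.
From HB Require Import structures.
From mathcomp Require Import all_boot all_order all_algebra.
From mathcomp Require Import complex ring lra.
From mathcomp Require Import classical_sets reals.

Import Order.TTheory GRing.Theory Num.Theory.
Local Open Scope classical_set_scope.
Local Open Scope ring_scope.
Local Open Scope complex_scope.

(** Write s for the number (sqrt 3 / 2) i, so that s ^+ 2 = - 3 / 4.  The
    denominator 1 - l + l ^+ 2 equals (1 / 2 - l - s) * (1 / 2 - l + s), and this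
    is what makes the system simultaneously diagonal: in the coordinates
      x1,  x3,  x2 + s x0,  x2 - s x0
    every quadric of the system is a sum of squares with non-zero weights
    ([polar_form_diag]).  The coordinate tetrahedron of these four linear forms
    is therefore self-polar with respect to all quadrics, since the polar plane
    of each of its vertices is the opposite coordinate plane
    ([polar_plane_tpoint], [face_coord_tetrahedron]).

    Uniqueness comes from the fact that, as functions of l, the four weights are
    linearly independent.  If x and y are conjugate with respect to all real
    quadrics of the system, then the products of their respective diagonal
    coordinates all vanish ([tcoord_conjugate]).  Two distinct vertices of a
    common self-polar tetrahedron are conjugate, hence no coordinate is non-zero
    at both.  There are four vertices and four coordinates, and every vertex has
    some non-zero coordinate, so every vertex has exactly one: the vertices are
    those of the coordinate tetrahedron, in some order
    ([common_self_polar_vertices]).  The faces follow, being the polar planes of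
    the vertices. *)

(** * Families indexed by four elements *)

Lemma forall_ord4 (A : 'I_4 -> Prop) :
  A 0 -> A 1 -> A 2 -> A 3 -> forall i, A i.
Proof.
move=> A0 A1 A2 A3 [[|[|[|[|//]]]] lti].
- by have -> : Ordinal lti = 0 by apply: val_inj.
- by have -> : Ordinal lti = 1 by apply: val_inj.
- by have -> : Ordinal lti = 2 by apply: val_inj.
- by have -> : Ordinal lti = 3 by apply: val_inj.
Qed.

Lemma range_ord4 (U : Type) (f : 'I_4 -> U) :
  range f = [set f 0; f 1; f 2; f 3].
Proof.
apply/seteqP; split=> [u [i _ <-]|u].
  by elim/forall_ord4: i; do ?[by right | left].
by move=> [[[]|]|] ->; eexists.
Qed.

Lemma range_perm {I : finType} {U : Type} {f g : I -> U} {h : I -> I} :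
  injective h -> (forall i, f i = g (h i)) -> range f = range g.
Proof.
move=> h_inj fgh; apply/seteqP; split=> u [i _ <-].
  by exists (h i); rewrite ?fgh.
by exists (invF h_inj i) => //; rewrite fgh f_invF.
Qed.

(** * The coordinate tetrahedron *)

Section SelfPolar.
Set Implicit Arguments.
Unset Strict Implicit.
Variable R : realType.
Local Notation C := R[i].
Local Notation V := 'rV[C]_4.
Local Notation s := (halfsqrt3i R).

Lemma halfsqrt3i_sqr : s ^+ 2 = - (3 / 4).
Proof.
rewrite /halfsqrt3i exprMn sqr_i -rmorphXn /= expr_div_n sqr_sqrtr ?ler0n //.
by rewrite rmorphM /= fmorphV rmorphXn /= !rmorph_nat; field.
Qed.

Lemma halfsqrt3i_neq0 : s != 0.
Proof.
rewrite -sqrf_eq0 halfsqrt3i_sqr oppr_eq0.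
by rewrite mulf_neq0 ?invr_neq0 ?pnatr_eq0.
Qed.

Lemma ppoint_inj : injective (@line R).
Proof.
move=> [U dU] [W dW] /= UW; rewrite -{W}UW in dW *.
by rewrite (eq_irrelevance dU dW).
Qed.

(** The linear forms of the four faces; the product of the last two is
    x2 ^+ 2 + 3 / 4 * x0 ^+ 2. *)
Definition tcoord (k : 'I_4) (x : V) : C :=
  [:: x 0 1; x 0 3; x 0 2 + s * x 0 0; x 0 2 - s * x 0 0]`_k.

Lemma tcoord_scalar k : scalar (tcoord k).
Proof.
by move=> a x y; elim/forall_ord4: k; rewrite /tcoord /= !mxE //; ring.
Qed.

HB.instance Definition _ k :=
  GRing.isLinear.Build C V C *%R (tcoord k) (tcoord_scalar k).

(** The vertices are numbered like the opposite faces: [tvec k] is the common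
    zero of the forms [tcoord j] for j different from k. *)
Definition tvec (k : 'I_4) : V :=
  [:: hvec 0 1 0 0; hvec 0 0 0 1; hvec 1 0 s 0; hvec 1 0 (- s) 0]`_k.

Definition tpoint (k : 'I_4) : ppoint R :=
  nth (point_Xinf R)
    [:: point_Xinf R; point_Zinf R; point_P R; point_Q R] k.

Definition tplane (k : 'I_4) : set (ppoint R) :=
  [set p : ppoint R | forall x, x \in line p -> tcoord k x = 0].

Lemma line_tpoint k : line (tpoint k) = <[tvec k]>%VS.
Proof. by elim/forall_ord4: k. Qed.

Lemma tcoord_tvec_neq k j : j != k -> tcoord k (tvec j) = 0.
Proof.
elim/forall_ord4: k; elim/forall_ord4: j => //= _;
  rewrite /tcoord /tvec /= !mxE /=; ring.
Qed.

Lemma tcoord_tvec k : tcoord k (tvec k) != 0.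
Proof.
elim/forall_ord4: k; rewrite /tcoord /tvec /= !mxE /= ?oner_eq0 // mulr1.
  by rewrite -mulr2n mulrn_eq0 negb_or halfsqrt3i_neq0.
by rewrite -mulr2n mulrn_eq0 oppr_eq0 negb_or halfsqrt3i_neq0.
Qed.

(** The vectors [tvec k] are, up to scaling, the basis dual to the forms
    [tcoord k]. *)
Lemma tcoord_decomp x :
  x = \sum_k (tcoord k x / tcoord k (tvec k)) *: tvec k.
Proof.
have ss : s + s != 0 by rewrite -mulr2n mulrn_eq0 negb_or halfsqrt3i_neq0.
apply/rowP; elim/forall_ord4; rewrite !big_ord_recl big_ord0 /= !mxE;
  rewrite /tcoord /tvec /= !mxE /=; field; rewrite -?opprD ?oppr_eq0 ss //.
Qed.

(** * Simultaneous diagonalisation of the system *)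

Definition tweight (l : C) (k : 'I_4) : C :=
  [:: (1 - l)^-1; l^-1; (2 * s * (1 / 2 - l - s))^-1;
      - (2 * s * (1 / 2 - l + s))^-1]`_k.

Lemma denom_factor (l : C) :
  1 - l + l ^+ 2 = (1 / 2 - l - s) * (1 / 2 - l + s).
Proof.
transitivity ((1 / 2 - l) ^+ 2 - s ^+ 2); last by ring.
by rewrite halfsqrt3i_sqr; field.
Qed.

Lemma tweight_neq0 l k : admissible l -> tweight l k != 0.
Proof.
move=> [l1]; rewrite denom_factor mulf_eq0 negb_or => /andP[lP lQ] l0.
have s0 := halfsqrt3i_neq0.
have two0 : (2 : C) != 0 by rewrite pnatr_eq0.
by elim/forall_ord4: k; rewrite /tweight /= ?oppr_eq0 invr_eq0 //;
  rewrite (mulf_neq0 (mulf_neq0 two0 s0)).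
Qed.

(** Since (1 / 2 - l) ^+ 2 - (1 - l + l ^+ 2) = - 3 / 4 = s ^+ 2, the part of the
    polar form in x0 and x2 is
      (x2 y2 + (1 / 2 - l) (x2 y0 + x0 y2) + s ^+ 2 x0 y0) / (1 - l + l ^+ 2),
    and both brackets x2 y2 + s ^+ 2 x0 y0 and x2 y0 + x0 y2 are combinations of
    the two products of coordinates x2 + s x0 and x2 - s x0. *)
Lemma polar_form_diag (l : C) (x y : V) : admissible l ->
  polar_form (ftilde l) x y =
    \sum_k tweight l k * (tcoord k x * tcoord k y).
Proof.
move=> [l1 D0 l0]; rewrite polar_form_ftilde.
rewrite !big_ord_recl big_ord0 /tweight /tcoord /=.
move: D0; rewrite denom_factor mulf_eq0 negb_or => /andP[lP lQ].
have s0 := halfsqrt3i_neq0.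
have two0 : (2 : C) != 0 by rewrite pnatr_eq0.
field; rewrite s0 l0 l1 andbT.
have -> : 1 + - l * 2 + s * 2 = 2 * (1 / 2 - l + s) by field.
have -> : 1 + - l * 2 + - s * 2 = 2 * (1 / 2 - l - s) by field.
by rewrite (mulf_neq0 two0 lP) (mulf_neq0 two0 lQ).
Qed.

(** Only the k-th term of the diagonal form survives at the k-th vertex, and its
    weight is not zero. *)
Lemma polar_plane_tpoint (l : C) k : admissible l ->
  polar_plane (ftilde l) (tpoint k) = tplane k.
Proof.
move=> ladm; have form_tvec a y : polar_form (ftilde l) (a *: tvec k) y =
    a * tweight l k * tcoord k (tvec k) * tcoord k y.
  rewrite polar_form_diag // (bigD1 k) //= big1 => [|j jk].
    by rewrite linearZ /=; ring.
  by rewrite linearZ /= tcoord_tvec_neq 1?eq_sym // !(mulr0, mul0r).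
apply/seteqP; split=> q hq; last first.
  move=> x y; rewrite line_tpoint => /vlineP[a ->] /hq yk.
  by rewrite form_tvec yk mulr0.
move=> y yq; have := hq (1 *: tvec k) y _ yq.
rewrite form_tvec mul1r scale1r line_tpoint memv_line => /(_ isT) /eqP.
rewrite !mulf_eq0 (negPf (tcoord_tvec k)) (negPf (tweight_neq0 k ladm)).
by move/eqP.
Qed.

(** * Points and faces of the coordinate tetrahedron *)

Lemma line_eq_tpoint (p : ppoint R) k :
  (forall x j, x \in line p -> j != k -> tcoord j x = 0) -> p = tpoint k.
Proof.
move=> pk; apply/ppoint_inj/eqP; rewrite eqEdim !dim_line andbT.
apply/subvP => x xp; rewrite line_tpoint (tcoord_decomp x) (bigD1 k) //=.
rewrite big1 ?addr0 ?memvZ ?memv_line // => j jk.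
by rewrite (pk x) // mul0r scale0r.
Qed.

Lemma tpoint_span : (\sum_(k < 4) line (tpoint k))%VS = fullv.
Proof.
apply/eqP; rewrite eqEsubv subvf; apply/subvP => x _; rewrite (tcoord_decomp x).
by apply: memv_sumr => k _; rewrite line_tpoint memvZ ?memv_line.
Qed.

Lemma tplane2E : tplane 2 = plane_I2 R.
Proof.
apply/seteqP; split=> q hq x /hq; rewrite /tcoord /= mulNr => /eqP.
  by rewrite addr_eq0 => /eqP.
by move/eqP=> ->; rewrite addNr.
Qed.

Lemma tplane3E : tplane 3 = plane_I1 R.
Proof.
apply/seteqP; split=> q hq x /hq; rewrite /tcoord /=.
  by move/eqP; rewrite subr_eq0 => /eqP.
by move=> ->; rewrite subrr.
Qed.

Definition coord_tetrahedron : tetrahedron R := Tetrahedron tpoint_span.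

Lemma face_coord_tetrahedron k : face coord_tetrahedron k = tplane k.
Proof.
apply/seteqP; split=> q hq.
  move=> x /(subvP hq) /memv_sumP[xs xsP ->]; rewrite linear_sum big1 //= => j jk.
  have := xsP j jk; rewrite line_tpoint => /vlineP[a ->].
  by rewrite linearZ /= tcoord_tvec_neq // mulr0.
apply/subvP => x /hq xk; rewrite (tcoord_decomp x) (bigD1 k) //= xk mul0r scale0r.
rewrite add0r; apply: memv_sumr => j _.
by rewrite line_tpoint memvZ ?memv_line.
Qed.

(** * Uniqueness *)

Lemma admissible_real (t : R) : t != 0 -> t != 1 -> admissible t%:C.
Proof.
move=> t0 t1; split;
  rewrite -?(rmorph1 (real_complex R)) -?rmorphXn -?rmorphB -?rmorphD /=.
- by rewrite fmorph_eq0 subr_eq0 eq_sym.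
- by rewrite fmorph_eq0; apply: lt0r_neq0; nra.
- by rewrite fmorph_eq0.
Qed.

(** Multiplied by t (1 - t) (1 - t + t ^+ 2), the polar form at x and y is a cubic
    polynomial in t, which vanishes at all real t other than 0 and 1 and so
    identically; its coefficients determine the four products. *)
Lemma tcoord_conjugate (x y : V) :
  (forall t : R, admissible t%:C -> polar_form (ftilde t%:C) x y = 0) ->
  forall k, tcoord k x * tcoord k y = 0.
Proof.
move=> conj.
pose a := x 0 1 * y 0 1; pose b := x 0 3 * y 0 3.
pose c := x 0 2 * y 0 2 - 3 / 4 * (x 0 0 * y 0 0).
pose d := x 0 2 * y 0 0 + x 0 0 * y 0 2.
pose p (t : C) := (a * t + b * (1 - t)) * (1 - t + t ^+ 2)
  + (c + (1 / 2 - t) * d) * (t * (1 - t)).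
have p_nat n : (1 < n)%N -> p n%:R = 0.
  move=> n1.
  have n0 : n%:R != 0 :> R by rewrite pnatr_eq0 -lt0n ltnW.
  have nN1 : n%:R != 1 :> R by rewrite pnatr_eq1 gtn_eqF.
  have nadm := admissible_real n0 nN1; have := conj _ nadm; move: nadm.
  rewrite rmorph_nat polar_form_ftilde; move: n%:R => t [t1 D0 t0] form0.
  rewrite -[RHS](mulr0 (t * (1 - t) * (1 - t + t ^+ 2))) -form0 /p /a /b /c /d.
  by field; rewrite t0 D0.
(* The cubic p has the value b at 0 and a at 1.  The coefficients below are
   those of the extrapolation of a cubic from the nodes 2, 3, 4, 5 to 0 and,
   in the next step, to 1. *)
have b0 : b = 0.
  transitivity (10 * p 2 - 20 * p 3 + 15 * p 4 - 4 * p 5).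
    by rewrite /p; field.
  by rewrite !p_nat // !mulr0 !(addr0, subr0).
have a0 : a = 0.
  transitivity (4 * p 2 - 6 * p 3 + 4 * p 4 - p 5); first by rewrite /p; field.
  by rewrite !p_nat // !mulr0 !(addr0, subr0).
have d0 : d = 0.
  transitivity ((p 3 - 3 * p 2 - 3 * a + 5 * b) / 6); last first.
    by rewrite !p_nat // a0 b0 !mulr0 !(addr0, subr0) mul0r.
  by rewrite /p; field.
have c0 : c = 0.
  transitivity ((6 * a - 3 * b + 3 * d - p 2) / 2); first by rewrite /p; field.
  by rewrite p_nat // a0 b0 d0 !mulr0 !(addr0, subr0) mul0r.
(* The first two products are a and b; the other two are c + s d and c - s d
   because s ^+ 2 = - 3 / 4. *)
elim/forall_ord4; rewrite /tcoord //=.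
  transitivity (c + s * d + (s ^+ 2 + 3 / 4) * (x 0 0 * y 0 0)).
    by rewrite /c /d; ring.
  by rewrite c0 d0 halfsqrt3i_sqr; ring.
transitivity (c - s * d + (s ^+ 2 + 3 / 4) * (x 0 0 * y 0 0)).
  by rewrite /c /d; ring.
by rewrite c0 d0 halfsqrt3i_sqr; ring.
Qed.

Lemma self_polar_conjugate (f : V -> C) (T : tetrahedron R) i j x y :
  self_polar f T -> i != j -> x \in line (vertex T i) ->
  y \in line (vertex T j) -> polar_form f x y = 0.
Proof.
move=> Tf ij xi yj.
have : polar_plane f (vertex T i) (vertex T j).
  by rewrite -Tf; apply: sumv_sup (subvv _); rewrite eq_sym.
exact.
Qed.

(** A coordinate that is non-zero on one vertex vanishes on all the others.
    Choosing for every vertex a non-zero coordinate gives an injection of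
    vertices into coordinates, hence a bijection; a second non-zero coordinate
    of a vertex would already belong to another vertex. *)
Lemma common_self_polar_vertices (L : set C) (T : tetrahedron R) :
  (forall t : R, admissible t%:C -> L t%:C) -> common_self_polar L T ->
  exists2 h : 'I_4 -> 'I_4, injective h & forall i, vertex T i = tpoint (h i).
Proof.
move=> L_real TL; pose w i := vpick (line (vertex T i)).
have w_line i : w i \in line (vertex T i) by exact: memv_pick.
have w_neq0 i : w i != 0 by rewrite vpick0 -dimv_eq0 dim_line.
have disj k i j x y : x \in line (vertex T i) -> y \in line (vertex T j) ->
    tcoord k x != 0 -> tcoord k y != 0 -> i = j.
  move=> xi yj kx ky; apply/eqP/negPn/negP => ij.
  have /eqP := mulf_neq0 kx ky; apply; apply: tcoord_conjugate => t tadm.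
  exact: self_polar_conjugate (TL _ (L_real _ tadm)) ij xi yj.
have w_coord i : exists k, tcoord k (w i) != 0.
  have [/existsP //|/existsPn w0] := boolP [exists k, tcoord k (w i) != 0].
  have /eqP[] := w_neq0 i; rewrite [w i]tcoord_decomp big1 // => k _.
  by have /negPn/eqP -> := w0 k; rewrite mul0r scale0r.
have [h hw] := boolp.choice w_coord.
have h_inj : injective h.
  move=> i j hij; apply: (disj (h i) _ _ _ _ (w_line i) (w_line j)) => //.
  by rewrite hij.
exists h => // i; apply: line_eq_tpoint => x j xi.
have /codomP[m ->] := injF_onto h_inj j.
apply: contraNeq => mx.
by rewrite (disj (h m) i m x (w m)).
Qed.

End SelfPolar.

Theorem theorem4 (R : realType) (L : set R[i])
    (L_real : forall t : R, admissible t%:C -> L t%:C)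
    (L_admissible : forall l : R[i], L l -> admissible l) :
  (exists T : tetrahedron R, common_self_polar L T) /\
  (forall T : tetrahedron R, common_self_polar L T ->
     faces T = [set plane_X1 R; plane_X3 R; plane_I1 R; plane_I2 R] /\
     vertices T =
       [set point_Xinf R; point_Zinf R; point_P R; point_Q R]).
Proof.
split=> [|T TL].
  exists (coord_tetrahedron R) => l /L_admissible ladm k.
  by rewrite face_coord_tetrahedron polar_plane_tpoint.
have [h h_inj vertexT] := common_self_polar_vertices L_real TL.
(* Any admissible real parameter serves to express faces as polar planes. *)
have two_adm : admissible (2%:R : R)%:C.
  by apply: admissible_real; rewrite ?pnatr_eq0 ?pnatr_eq1.
have faceT i : face T i = tplane (h i).
  by rewrite (TL _ (L_real _ two_adm)) vertexT polar_plane_tpoint.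
split; last by rewrite /vertices (range_perm h_inj vertexT) range_ord4.
rewrite /faces (range_perm h_inj faceT) range_ord4 tplane2E tplane3E.
(* The face opposite to P is I2 and that opposite to Q is I1, so these two planes
   are listed in the reverse order. *)
by rewrite setUAC.
Qed.
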